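(* Let $(k_n)_{n\ge1}$ be a positive sequence with $\sum_{j\ge1}k_j\le1$, let $a=-\sum_{j\ge1}k_j$, and let $\lambda_n:=\sum_{j\ge n}k_j$ for $n\ge1$, $\lambda_0:=1$. Suppose (C2') $\lambda_n^2\le\lambda_{n-1}\lambda_{n+1}$ for all $n\ge1$ (Kaluza sequence) and (C3') $\lambda_n=L(n)n^{-\alpha}$ with $\alpha\in(0,1)$ and $(L(n))_n$ a slowly varying sequence. Then the discrete resolvent $r$ satisfies $$\lim_{n\to\infty}n^{1-\alpha}L(n)r_n=\frac{\sin(\alpha\pi)}{\pi}.$$
   Context: The discrete resolvent $r=(r_n)_{n\ge0}$ is the unique solution of $r_{n+1}-r_n=ar_n+\sum_{j=1}^nk_jr_{n-j}$ for $n\ge0$, $r_0=1$. A sequence $(c_n)$ of positive numbers is regularly varying of index $\rho$ if $c_{[\lambda n]}/c_n\to\lambda^\rho$ as $n\to\infty$ for every $\lambda>0$ ($[x]$ = integer part); slowly varying means $\rho=0$. *)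

(* Defs.v *)
From Stdlib Require Import Reals ZArith.
Open Scope R_scope.

Fixpoint sum1 (f : nat -> R) (n : nat) : R :=
  match n with
  | O => 0
  | S m => sum1 f m + f (S m)
  end.

(* lambda_0 = 1, lambda_n = sum_{j >= n} k_j = S - (k_1 + ... + k_{n-1}) for n >= 1,
   where S = sum_{j >= 1} k_j. *)
Definition tail_lambda (k : nat -> R) (Ssum : R) (n : nat) : R :=
  match n with
  | O => 1
  | S m => Ssum - sum1 k m
  end.

Definition nat_floor (x : R) : nat := Z.to_nat (Int_part x).

Definition regularly_varying (c : nat -> R) (rho : R) : Prop :=
  (forall n, 0 < c n) /\
  forall lam : R, 0 < lam ->
    Un_cv (fun n => c (nat_floor (lam * INR n)) / c n) (Rpower lam rho).

Definition slowly_varying (c : nat -> R) : Prop := regularly_varying c 0.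

Definition is_resolvent (a : R) (k r : nat -> R) : Prop :=
  r O = 1 /\
  forall n : nat, r (S n) - r n = a * r n + sum1 (fun j => k j * r (n - j)%nat) n.

(* Main.v *)
(* The hypotheses say that the tails [lam] satisfy [lam * r = 1] (convolution), and log-convexity
   makes [r] decreasing, by Kaluza's argument. Compare [lam] with the explicit sequence
   [p n = prod_(k <= n) (1 - al / k)], which is also regularly varying of index [- al] and has the
   explicit inverse [q n = prod_(k <= n) (1 - (1 - al) / k)], [p * q = 1]. By monotonicity,
   [lam j / lam N - p j / p N], [j <= N], tends to [0] in mean; convolving with [r] and [q] turns
   this into [lam N / p N * (r * 1) ~ q * 1] in mean on [0..N]. Summing once more gives a uniform
   estimate, and second differences over windows of length [N / M] recover
   [lam N * r N ~ p N * q N], as [r] and [q] are monotone. Finally [n * p n * q n] tends to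
   [sin (al * PI) / PI], which is Euler's product for the sine; it is obtained here from the
   integrals of [cos (2 y t) cos(t)^(2n)] over [0, PI / 2]. *)
Require Import Defs.
From Stdlib Require Import Reals ZArith Lra Lia.
From Coquelicot Require Import Coquelicot.
Open Scope R_scope.

(** * Sums and convolutions *)

(** Both sides run over the pairs [(j, k)] with [j + k <= n], along antidiagonals on the left and
    along rows on the right. *)
Lemma sum_triangle (F : nat -> nat -> R) (n : nat) :
  sum_f_R0 (fun i => sum_f_R0 (fun j => F j (i - j)%nat) i) n
  = sum_f_R0 (fun j => sum_f_R0 (F j) (n - j)) n.
Proof.
  induction n as [|n IH]; [reflexivity|].
  rewrite tech5, IH, (tech5 (fun j => F j (S n - j)%nat)), Nat.sub_diag.
  rewrite (tech5 (fun j => sum_f_R0 (F j) (S n - j))), Nat.sub_diag; simpl (sum_f_R0 _ 0).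
  rewrite <- Rplus_assoc; f_equal.
  rewrite <- plus_sum; apply sum_eq; intros i Hi.
  now rewrite (Nat.sub_succ_l i n Hi), tech5.
Qed.

Lemma sum_rev (f : nat -> R) (n : nat) :
  sum_f_R0 (fun j => f (n - j)%nat) n = sum_f_R0 f n.
Proof.
  induction n as [|n IH]; [reflexivity|].
  rewrite (decomp_sum (fun j => f (S n - j)%nat)) by lia.
  simpl pred; rewrite tech5, <- IH, Rplus_comm; f_equal.
Qed.

Lemma sum_increasing (f : nat -> R) (m n : nat) :
  (forall j, 0 <= f j) -> (m <= n)%nat -> sum_f_R0 f m <= sum_f_R0 f n.
Proof.
  intros Hf Hmn; induction Hmn as [|n _ IH]; [lra|].
  rewrite tech5; specialize (Hf (S n)); lra.
Qed.

Lemma increment_le (f : nat -> R) (c : R) (n m : nat) :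
  (forall i, (n <= i < n + m)%nat -> f (S i) - f i <= c) ->
  f (n + m)%nat - f n <= INR m * c.
Proof.
  induction m as [|m IH]; intros H.
  - rewrite Nat.add_0_r; simpl; lra.
  - rewrite Nat.add_succ_r, S_INR.
    assert (f (n + m)%nat - f n <= INR m * c) by (apply IH; intros; apply H; lia).
    specialize (H (n + m)%nat ltac:(lia)); lra.
Qed.

Lemma increment_ge (f : nat -> R) (c : R) (n m : nat) :
  (forall i, (n <= i < n + m)%nat -> c <= f (S i) - f i) ->
  INR m * c <= f (n + m)%nat - f n.
Proof.
  intros H.
  enough (- f (n + m)%nat - - f n <= INR m * - c) by lra.
  apply (increment_le (fun i => - f i)); intros i Hi; specialize (H i Hi); lra.
Qed.

Definition sum_sum (f : nat -> R) : nat -> R := sum_f_R0 (sum_f_R0 f).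

(** The second difference of [sum_sum f] with step [m] is a sum of [m ^ 2] values [f j] with
    [n < j <= n + 2 m]. Monotonicity bounds each by [f n] here, and from below by [f (n + m + m)] in
    the companion lemma. This is how pointwise values are recovered from doubly summed ones. *)
Lemma second_difference_le (f : nat -> R) (n m : nat) :
  Un_decreasing f ->
  sum_sum f (n + m + m) - 2 * sum_sum f (n + m) + sum_sum f n <= INR m ^ 2 * f n.
Proof.
  intros Hf.
  enough ((sum_sum f (n + m + m) - sum_sum f (n + m)) - (sum_sum f (n + m) - sum_sum f n)
            <= INR m * (INR m * f n)) by lra.
  apply (increment_le (fun i => sum_sum f (i + m) - sum_sum f i)); intros i Hi.
  enough (sum_f_R0 f (S i + m) - sum_f_R0 f (S i) <= INR m * f n)
    by (unfold sum_sum; cbn [Nat.add] in *; rewrite !(tech5 (sum_f_R0 f)); lra).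
  apply increment_le; intros j Hj; rewrite tech5.
  assert (f (S j) <= f n) by (apply decreasing_prop; [assumption|lia]); lra.
Qed.

Lemma second_difference_ge (f : nat -> R) (n m : nat) :
  Un_decreasing f ->
  INR m ^ 2 * f (n + m + m)%nat
    <= sum_sum f (n + m + m) - 2 * sum_sum f (n + m) + sum_sum f n.
Proof.
  intros Hf.
  enough (INR m * (INR m * f (n + m + m)%nat)
            <= (sum_sum f (n + m + m) - sum_sum f (n + m)) - (sum_sum f (n + m) - sum_sum f n))
    by lra.
  apply (increment_ge (fun i => sum_sum f (i + m) - sum_sum f i)); intros i Hi.
  enough (INR m * f (n + m + m)%nat <= sum_f_R0 f (S i + m) - sum_f_R0 f (S i))
    by (unfold sum_sum; cbn [Nat.add] in *; rewrite !(tech5 (sum_f_R0 f)); lra).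
  apply increment_ge; intros j Hj; rewrite tech5.
  assert (f (n + m + m)%nat <= f (S j)) by (apply decreasing_prop; [assumption|lia]); lra.
Qed.

Definition conv (f g : nat -> R) (n : nat) : R :=
  sum_f_R0 (fun j => f j * g (n - j)%nat) n.

Lemma conv_ext (f f' g g' : nat -> R) (n : nat) :
  (forall j, (j <= n)%nat -> f j = f' j) -> (forall j, (j <= n)%nat -> g j = g' j) ->
  conv f g n = conv f' g' n.
Proof.
  intros Hf Hg; apply sum_eq; intros j Hj; rewrite Hf, Hg by lia; reflexivity.
Qed.

Lemma conv_comm (f g : nat -> R) (n : nat) : conv f g n = conv g f n.
Proof.
  unfold conv; rewrite <- sum_rev; apply sum_eq; intros j Hj.
  replace (n - (n - j))%nat with j by lia; apply Rmult_comm.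
Qed.

Lemma conv_assoc (f g h : nat -> R) (n : nat) :
  conv (conv f g) h n = conv f (conv g h) n.
Proof.
  unfold conv; pose (F := fun j k => f j * g k * h (n - j - k)%nat).
  transitivity (sum_f_R0 (fun i => sum_f_R0 (fun j => F j (i - j)%nat) i) n).
  - apply sum_eq; intros i Hi; rewrite Rmult_comm, scal_sum.
    apply sum_eq; intros j Hj; unfold F; replace (n - j - (i - j))%nat with (n - i)%nat by lia; ring.
  - rewrite sum_triangle; apply sum_eq; intros j Hj; rewrite scal_sum.
    apply sum_eq; intros k Hk; unfold F; ring.
Qed.

Lemma conv_lin_l (a b : R) (f g h : nat -> R) (n : nat) :
  conv (fun j => a * f j + b * g j) h n = a * conv f h n + b * conv g h n.
Proof.
  unfold conv; rewrite !scal_sum, <- plus_sum; apply sum_eq; intros j Hj; ring.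
Qed.

Lemma conv_1_r (f : nat -> R) (n : nat) : conv f (fun _ => 1) n = sum_f_R0 f n.
Proof. apply sum_eq; intros; ring. Qed.

Lemma conv_1_l (f : nat -> R) (n : nat) : conv (fun _ => 1) f n = sum_f_R0 f n.
Proof. now rewrite conv_comm, conv_1_r. Qed.

(** The pairs with [j + k <= n] form part of the square [[0..n] x [0..n]], so the truncated l1 norm
    is submultiplicative. *)
Lemma sum_abs_conv (f g : nat -> R) (n : nat) :
  sum_f_R0 (fun i => Rabs (conv f g i)) n
  <= sum_f_R0 (fun i => Rabs (f i)) n * sum_f_R0 (fun i => Rabs (g i)) n.
Proof.
  pose (F := fun j k => Rabs (f j) * Rabs (g k)).
  apply Rle_trans with (sum_f_R0 (fun i => sum_f_R0 (fun j => F j (i - j)%nat) i) n).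
  - apply sum_Rle; intros i _; unfold conv.
    eapply Rle_trans; [apply Rsum_abs|].
    apply Req_le, sum_eq; intros; apply Rabs_mult.
  - rewrite sum_triangle, Rmult_comm, scal_sum; apply sum_Rle; intros j Hj.
    rewrite (sum_eq (F j) (fun k => Rabs (g k) * Rabs (f j))) by (intros; unfold F; ring).
    rewrite <- scal_sum; apply Rmult_le_compat_l; [apply Rabs_pos|].
    apply sum_increasing; [intros; apply Rabs_pos|lia].
Qed.

(** Each term [f j * g (n - j)] of the convolution is at least [f n * g (n - j)]. *)
Lemma sum_le_inv_of_conv (f g : nat -> R) (n : nat) :
  Un_decreasing f -> (forall j, 0 <= g j) -> conv f g n = 1 ->
  f n * sum_f_R0 g n <= 1.
Proof.
  intros Hf Hg H; rewrite <- H, conv_comm, scal_sum; apply sum_Rle; intros j Hj.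
  apply Rmult_le_compat_l; [apply Hg|apply decreasing_prop; [assumption|lia]].
Qed.

(** * The model sequences and the sine product *)

(** In closed form, $(-1)^n\binom{al-1}{n}$. *)
Fixpoint binom_prod (al : R) (n : nat) : R :=
  match n with
  | O => 1
  | S m => binom_prod al m * (1 - al / INR (S m))
  end.

Lemma INR_S_pos (n : nat) : 0 < INR (S n).
Proof. apply lt_0_INR; lia. Qed.

Lemma binom_prod_factor_pos (al : R) (n : nat) :
  al < 1 -> 0 < 1 - al / INR (S n).
Proof.
  intros H; pose proof (INR_S_pos n); assert (1 <= INR (S n)) by (rewrite S_INR; pose proof (pos_INR n); lra).
  apply Rmult_lt_reg_r with (INR (S n)); [assumption|field_simplify; lra].
Qed.

Lemma binom_prod_pos (al : R) (n : nat) : al < 1 -> 0 < binom_prod al n.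
Proof.
  intros H; induction n as [|n IH]; cbn [binom_prod]; [lra|].
  apply Rmult_lt_0_compat; [assumption|now apply binom_prod_factor_pos].
Qed.

Lemma binom_prod_decreasing (al : R) : 0 < al < 1 -> Un_decreasing (binom_prod al).
Proof.
  intros H n; cbn [binom_prod]; pose proof (INR_S_pos n).
  assert (0 < al / INR (S n)) by (apply Rdiv_lt_0_compat; lra).
  pose proof (binom_prod_pos al n (proj2 H)); nra.
Qed.

Lemma binom_prod_rec (al : R) (n : nat) :
  INR (S n) * binom_prod al (S n) = (INR (S n) - al) * binom_prod al n.
Proof. pose proof (INR_S_pos n); cbn [binom_prod]; field; lra. Qed.

(* The generating functions are (1 - z)^(al - 1) and (1 - z)^(- al). *)
Lemma conv_binom_prod (al : R) (n : nat) :
  conv (binom_prod al) (binom_prod (1 - al)) n = 1.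
Proof.
  set (p := binom_prod al); set (q := binom_prod (1 - al)).
  induction n as [|n IH]; [unfold conv, p, q; simpl; ring|].
  apply Rmult_eq_reg_l with (INR (S n)); [|pose proof (INR_S_pos n); lra].
  rewrite Rmult_1_r.
  (* The weight [S n] is split as [j + (S n - j)], as in the product rule for generating functions.
     After the recurrences of [p] and [q], the coefficients [j + 1 - al] and [n - j + al] add up to
     [n + 1]. *)
  transitivity (sum_f_R0 (fun j => INR j * p j * q (S n - j)%nat) (S n)
    + sum_f_R0 (fun j => p j * (INR (S n - j) * q (S n - j)%nat)) (S n)).
  { unfold conv; rewrite scal_sum, <- plus_sum; apply sum_eq; intros j Hj.
    rewrite minus_INR by assumption; ring. }
  rewrite decomp_sum by lia; rewrite (tech5 (fun j => p j * _)), Nat.sub_diag; simpl pred.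
  simpl (INR 0); rewrite !Rmult_0_l, Rmult_0_r, Rplus_0_l, Rplus_0_r, <- plus_sum.
  transitivity (INR (S n) * conv p q n); [|rewrite IH; ring].
  unfold conv; rewrite scal_sum; apply sum_eq; intros j Hj.
  rewrite (Nat.sub_succ_l j n Hj); unfold p at 1, q at 2; rewrite !binom_prod_rec.
  fold p q; replace (S n - S j)%nat with (n - j)%nat by lia.
  rewrite !S_INR, minus_INR by assumption; ring.
Qed.

(** For [y = 0] this is the Wallis integral. With frequency [2 * y] the value at [n = 0] is
    [sin (y * PI) / (2 * y)], which is where the sine comes from. *)
Definition wallis (y : R) (n : nat) : R :=
  RInt (fun t => cos (2 * y * t) * cos t ^ (2 * n)) 0 (PI / 2).

Lemma ex_RInt_wallis (y : R) (n : nat) :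
  ex_RInt (fun t => cos (2 * y * t) * cos t ^ n) 0 (PI / 2).
Proof.
  apply (ex_RInt_continuous (V := R_CompleteNormedModule)); intros t _.
  apply (ex_derive_continuous (V := R_NormedModule)); auto_derive; trivial.
Qed.

(** The primitive comes from integrating by parts twice. It vanishes at [0] and at [PI / 2], so the
    integral of the derivative gives a two-term recurrence in the exponent. It is applied with
    [2 * y] for [y] and with an even [n]. *)
Lemma is_derive_wallis_primitive (y t : R) (n : nat) :
  is_derive (fun t => y * sin (y * t) * cos t ^ S (S n)
                      - (INR n + 2) * cos (y * t) * sin t * cos t ^ S n) t
    ((y ^ 2 - (INR n + 2) ^ 2) * (cos (y * t) * cos t ^ S (S n))
     + (INR n + 2) * (INR n + 1) * (cos (y * t) * cos t ^ n)).
Proof.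
  auto_derive; [trivial|].
  change (match n with O => 1 | S _ => INR n + 1 end) with (INR (S n)); rewrite S_INR.
  assert (H : sin t ^ 2 = 1 - cos t ^ 2) by (pose proof (sin2_cos2 t); unfold Rsqr in *; lra).
  simpl Nat.pred; simpl pow in *.
  ring [H].
Qed.

(** Each step in [n] brings in one factor of Euler's product for the sine. *)
Lemma wallis_rec (y : R) (n : nat) :
  (1 - y ^ 2 / INR (S n) ^ 2) * wallis y (S n) = (2 * INR n + 1) / (2 * INR n + 2) * wallis y n.
Proof.
  set (k := (2 * n)%nat); assert (Hk : INR k = 2 * INR n) by (unfold k; rewrite mult_INR; simpl; lra).
  set (a := (2 * y) ^ 2 - (INR k + 2) ^ 2); set (b := (INR k + 2) * (INR k + 1)).
  assert (E : a * wallis y (S n) + b * wallis y n = 0).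
  { unfold wallis; fold k; replace (2 * S n)%nat with (S (S k)) by (unfold k; lia).
    set (G := fun t => 2 * y * sin (2 * y * t) * cos t ^ S (S k)
                       - (INR k + 2) * cos (2 * y * t) * sin t * cos t ^ S k).
    replace 0 with (minus (G (PI / 2)) (G 0)) at 3
      by (unfold minus, plus, opp, G; simpl; rewrite Rmult_0_r, sin_0, cos_PI2; ring).
    rewrite <- (is_RInt_unique (fun t => a * (cos (2 * y * t) * cos t ^ S (S k))
                                       + b * (cos (2 * y * t) * cos t ^ k)) 0 (PI / 2)
                  (minus (G (PI / 2)) (G 0))).
    - symmetry; apply is_RInt_unique.
      apply (is_RInt_plus (V := R_NormedModule)); apply (is_RInt_scal (V := R_NormedModule));
        apply (RInt_correct (V := R_CompleteNormedModule)), ex_RInt_wallis.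
    - apply (is_RInt_derive (V := R_CompleteNormedModule)); intros t _.
      + apply is_derive_wallis_primitive.
      + apply (ex_derive_continuous (V := R_NormedModule)); auto_derive; trivial. }
  unfold a, b in E; rewrite Hk in E; rewrite !S_INR; pose proof (pos_INR n).
  apply Rmult_eq_reg_l with (4 * (INR n + 1) ^ 2); [|nra].
  transitivity (4 * ((INR n + 1) ^ 2 - y ^ 2) * wallis y (S n)); [field; lra|].
  transitivity ((2 * INR n + 2) * (2 * INR n + 1) * wallis y n); [lra|field; lra].
Qed.

Lemma wallis_0 (y : R) : 0 < y -> wallis y 0 = sin (y * PI) / (2 * y).
Proof.
  intros Hy; unfold wallis; apply is_RInt_unique.
  set (G := fun t => sin (2 * y * t) / (2 * y)).
  replace (sin (y * PI) / (2 * y)) with (minus (G (PI / 2)) (G 0)).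
  - apply (is_RInt_derive (V := R_CompleteNormedModule)); intros t _.
    + unfold G; auto_derive; [trivial|]; simpl; field; lra.
    + apply (ex_derive_continuous (V := R_NormedModule)); auto_derive; trivial.
  - unfold minus, plus, opp, G; simpl; rewrite Rmult_0_r, sin_0.
    replace (2 * y * (PI / 2)) with (y * PI) by field; field; lra.
Qed.

Lemma wallis_0_0 : wallis 0 0 = PI / 2.
Proof.
  unfold wallis; rewrite (RInt_ext _ (fun _ => 1)).
  - rewrite RInt_const; unfold scal; simpl; unfold mult; simpl; ring.
  - intros t _; rewrite Rmult_0_r, Rmult_0_l, cos_0; simpl; ring.
Qed.

Lemma wallis_0_rec (n : nat) :
  wallis 0 (S n) = (1 - / (2 * INR (S n))) * wallis 0 n.
Proof.
  pose proof (wallis_rec 0 n) as H; rewrite !S_INR in *; pose proof (pos_INR n).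
  transitivity ((2 * INR n + 1) / (2 * INR n + 2) * wallis 0 n); [|field; lra].
  rewrite <- H; field; lra.
Qed.

Lemma wallis_0_pos (n : nat) : 0 < wallis 0 n.
Proof.
  induction n as [|n IH]; [rewrite wallis_0_0; pose proof PI_RGT_0; lra|].
  rewrite wallis_0_rec; apply Rmult_lt_0_compat; [|assumption].
  pose proof (binom_prod_factor_pos (/ 2) n ltac:(lra)) as H.
  replace (/ (2 * INR (S n))) with (/ 2 / INR (S n)); [assumption|].
  pose proof (INR_S_pos n); field; lra.
Qed.

(* [1 - cos (2 y t) = 2 sin(y t)^2 <= 2 sin(t)^2] on [0, PI / 2], and
   [sin^2 cos^(2n)] integrates to [wallis 0 n - wallis 0 (n + 1)]. *)
Lemma wallis_bounds (y : R) (n : nat) :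
  0 < y < 1 ->
  (1 - / INR (S n)) * wallis 0 n <= wallis y n <= wallis 0 n.
Proof.
  intros Hy; pose proof PI_RGT_0.
  assert (Hc : forall t, 0 <= cos t ^ (2 * n)) by (intros t; rewrite pow_mult; apply pow_le, pow2_ge_0).
  split.
  - replace ((1 - / INR (S n)) * wallis 0 n) with (2 * wallis 0 (S n) + (-1) * wallis 0 n)
      by (rewrite wallis_0_rec; pose proof (INR_S_pos n); field; lra).
    unfold wallis at 1 2.
    erewrite <- (is_RInt_unique _ 0 (PI / 2) (_ + _)).
    2:{ apply (is_RInt_plus (V := R_NormedModule)); apply (is_RInt_scal (V := R_NormedModule));
        apply (RInt_correct (V := R_CompleteNormedModule)), ex_RInt_wallis. }
    apply RInt_le; [lra| |apply ex_RInt_wallis|].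
    { apply (ex_RInt_plus (V := R_NormedModule)); apply (ex_RInt_scal (V := R_NormedModule)), ex_RInt_wallis. }
    intros t Ht; unfold plus, scal; simpl plus; unfold mult; cbn -[pow Nat.mul cos INR].
    replace (2 * S n)%nat with (2 + 2 * n)%nat by lia.
    rewrite pow_add, Rmult_0_r, Rmult_0_l, cos_0.
    enough (2 * cos t ^ 2 - 1 <= cos (2 * y * t)) by (specialize (Hc t); nra).
    rewrite Rmult_assoc, cos_2a_sin.
    pose proof (sin2_cos2 t) as Ht2; unfold Rsqr in Ht2.
    assert (0 <= sin (y * t)) by (apply sin_ge_0; nra).
    assert (sin (y * t) <= sin t) by (apply sin_incr_1; nra).
    nra.
  - apply RInt_le; [lra|apply ex_RInt_wallis|apply ex_RInt_wallis|].
    intros t _; rewrite Rmult_0_r, Rmult_0_l, cos_0.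
    apply Rmult_le_compat_r; [apply Hc|apply COS_bound].
Qed.

(** From [n] to [n + 1] the factor before [wallis] is multiplied by [1 - al ^ 2 / (n + 1) ^ 2],
    because the new factor [1 - (1 - al) / (n + 1)] equals [(n + al) / (n + 1)]. By [wallis_rec],
    both sides are then multiplied by [(2 n + 1) / (2 n + 2)]. *)
Lemma binom_prod_wallis (al : R) (n : nat) :
  0 < al < 1 ->
  (INR n + al) * (binom_prod al n * binom_prod (1 - al) n) * wallis al n
  = sin (al * PI) / PI * wallis 0 n.
Proof.
  intros Hal; induction n as [|n IH].
  - simpl (binom_prod _ 0); simpl (INR 0); rewrite wallis_0, wallis_0_0 by lra.
    pose proof PI_RGT_0; field; lra.
  - pose proof (wallis_rec al n) as H; pose proof (wallis_0_rec n) as H0.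
    cbn [binom_prod]; rewrite S_INR in *; pose proof (pos_INR n).
    transitivity ((INR n + al) * (binom_prod al n * binom_prod (1 - al) n)
                  * ((1 - al ^ 2 / (INR n + 1) ^ 2) * wallis al (S n))); [field; lra|].
    rewrite H, H0.
    transitivity ((2 * INR n + 1) / (2 * INR n + 2)
       * ((INR n + al) * (binom_prod al n * binom_prod (1 - al) n) * wallis al n)); [ring|].
    rewrite IH; field; pose proof PI_RGT_0; lra.
Qed.

Lemma is_lim_seq_of_le_inv (u : nat -> R) (l : R) :
  (forall n, (1 <= n)%nat -> Rabs (u n - l) <= / INR n) -> is_lim_seq u l.
Proof.
  intros H; apply is_lim_seq_Reals; intros eps Heps.
  destruct (archimed_cor1 eps Heps) as [N [HN HN0]].
  exists N; intros n Hn; unfold Rdist.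
  eapply Rle_lt_trans; [apply H; lia|].
  eapply Rle_lt_trans; [|exact HN].
  apply Rinv_le_contravar; [now apply lt_0_INR|now apply le_INR].
Qed.

Lemma is_lim_seq_INR_binom_prod (al : R) :
  0 < al < 1 ->
  is_lim_seq (fun n => INR n * binom_prod al n * binom_prod (1 - al) n) (sin (al * PI) / PI).
Proof.
  intros Hal; apply is_lim_seq_of_le_inv; intros n Hn.
  set (s := sin (al * PI) / PI); set (x := binom_prod al n * binom_prod (1 - al) n).
  assert (Hs : 0 <= s <= 1).
  { pose proof PI_RGT_0; pose proof PI2_1; pose proof (SIN_bound (al * PI)).
    assert (0 <= sin (al * PI)) by (apply sin_ge_0; nra).
    split; apply Rmult_le_reg_r with PI; trivial; unfold s; field_simplify; lra. }
  assert (HW := binom_prod_wallis al n Hal); fold s x in HW.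
  assert (HW0 := wallis_0_pos n); destruct (wallis_bounds al n Hal) as [HWl HWu].
  assert (HN : 1 <= INR n) by (change 1 with (INR 1); now apply le_INR).
  assert (Hx : 0 < x) by (apply Rmult_lt_0_compat; apply binom_prod_pos; lra).
  rewrite Rmult_assoc; fold x; clearbody s x.
  (* The two bounds on [wallis al n / wallis 0 n] give [s <= (n + al) x <= (1 + 1 / n) s]. *)
  assert (H1 : s <= (INR n + al) * x).
  { apply Rmult_le_reg_r with (wallis 0 n); [assumption|]; rewrite <- HW.
    apply Rmult_le_compat_l; nra. }
  assert (H2 : INR n * ((INR n + al) * x) <= (INR n + 1) * s).
  { apply Rmult_le_reg_r with (wallis 0 n); [assumption|].
    rewrite (Rmult_assoc (_ + 1)), <- HW, S_INR in *.
    transitivity ((INR n + 1) * ((INR n + al) * x * ((1 - / (INR n + 1)) * wallis 0 n)));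
      [apply Req_le; field; lra|].
    apply Rmult_le_compat_l; [lra|]; apply Rmult_le_compat_l; nra. }
  (* This controls the cost of replacing [n + al] by [n]; with [s <= 1] the total error is at most
     [1 / n]. *)
  assert (H3 : al * (INR n * x) <= s).
  { assert (0 <= INR n * (1 - al) * s) by (repeat apply Rmult_le_pos; lra).
    apply Rmult_le_compat_l with (r := al) in H2; [|lra].
    apply Rmult_le_reg_l with (INR n + al); lra. }
  apply Rmult_le_reg_l with (INR n); [lra|].
  rewrite <- (Rabs_pos_eq (INR n)) at 1 by lra; rewrite <- Rabs_mult, Rinv_r by lra.
  apply Rmult_le_compat_l with (r := INR n) in H1; [|lra].
  assert (0 <= al * (INR n * x)) by (apply Rmult_le_pos; nra).
  apply Rabs_le; lra.
Qed.

(** * Regularly varying decreasing sequences *)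

Lemma INR_div_bounds (a b : nat) :
  (0 < b)%nat -> INR a / INR b - 1 < INR (a / b) <= INR a / INR b.
Proof.
  intros Hb; assert (HB := lt_0_INR b Hb).
  assert (H := Nat.div_mod a b ltac:(lia)); assert (H' := Nat.mod_upper_bound a b ltac:(lia)).
  apply (f_equal INR) in H; rewrite plus_INR, mult_INR in H.
  apply lt_INR in H'; pose proof (pos_INR (a mod b)).
  split; apply Rmult_lt_reg_r with (INR b) || apply Rmult_le_reg_r with (INR b);
    trivial; field_simplify; lra.
Qed.

Lemma nat_floor_div (i M n : nat) :
  (0 < M)%nat -> nat_floor (INR i / INR M * INR n) = (i * n / M)%nat.
Proof.
  intros HM; unfold nat_floor.
  rewrite <- (Int_part_spec _ (Z.of_nat (i * n / M))), Nat2Z.id; trivial.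
  rewrite <- INR_IZR_INZ; pose proof (INR_div_bounds (i * n) M HM) as H.
  rewrite mult_INR in H.
  replace (INR i / INR M * INR n) with (INR i * INR n / INR M); [lra|].
  field; apply not_0_INR; lia.
Qed.

Lemma is_lim_seq_div_ratio (i M : nat) :
  (0 < M)%nat -> is_lim_seq (fun n => INR (i * n / M) / INR n) (INR i / INR M).
Proof.
  intros HM; apply is_lim_seq_of_le_inv; intros n Hn.
  assert (HN := lt_0_INR n Hn); assert (HM' := lt_0_INR M HM).
  pose proof (INR_div_bounds (i * n) M HM) as H; rewrite mult_INR in H.
  replace (INR (i * n / M) / INR n - INR i / INR M)
    with ((INR (i * n / M) - INR i * INR n / INR M) * / INR n) by (field; lra).
  rewrite Rabs_mult, (Rabs_pos_eq (/ INR n)) by (left; now apply Rinv_0_lt_compat).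
  rewrite <- (Rmult_1_l (/ INR n)) at 2; apply Rmult_le_compat_r.
  - left; now apply Rinv_0_lt_compat.
  - apply Rabs_le; lra.
Qed.

Lemma div_ge_1 (i M n : nat) : (1 <= i)%nat -> (1 <= M <= n)%nat -> (1 <= i * n / M)%nat.
Proof. intros; apply Nat.div_le_lower_bound; nia. Qed.

Lemma continuous_Rpower_l (al x : R) : 0 < x -> continuous (fun x => Rpower x al) x.
Proof.
  intros Hx; apply continuity_pt_filterlim, derivable_continuous_pt.
  eexists; apply derivable_pt_lim_power, Hx.
Qed.

(** Regular variation of index [- al] is stated at rational ratios in [(0, 1]], where the integer
    part becomes a Euclidean division. Between these grid points monotonicity takes over. *)
Definition regular_decreasing (al : R) (f : nat -> R) : Prop :=
  (forall n, 0 < f n) /\ Un_decreasing f /\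
  forall i M, (1 <= i <= M)%nat ->
    is_lim_seq (fun n => f (i * n / M)%nat / f n) (Rpower (INR i / INR M) (- al)).

Lemma regular_decreasing_intro (al : R) (f L : nat -> R) :
  (forall n, 0 < f n) -> Un_decreasing f ->
  (forall n, (1 <= n)%nat -> f n = L n * Rpower (INR n) (- al)) ->
  (forall i M, (1 <= i <= M)%nat -> is_lim_seq (fun n => L (i * n / M)%nat / L n) 1) ->
  regular_decreasing al f.
Proof.
  intros Hf Hd HfL HL; do 2 (split; [assumption|]); intros i M HiM.
  assert (HI : 0 < INR i) by (apply lt_0_INR; lia); assert (HM : 0 < INR M) by (apply lt_0_INR; lia).
  rewrite <- (Rmult_1_l (Rpower _ _)).
  apply is_lim_seq_ext_loc with (fun n => L (i * n / M)%nat / L n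
                                          * Rpower (INR (i * n / M) / INR n) (- al)).
  (* For [n >= M] the index [i * n / M] is at least [1], so the factorization of [f] holds there
     too. *)
  - exists M; intros n Hn.
    assert (Hm := div_ge_1 i M n ltac:(lia) ltac:(lia)); set (m := (i * n / M)%nat) in *.
    assert (0 < INR m) by (apply lt_0_INR; lia); assert (0 < INR n) by (apply lt_0_INR; lia).
    assert (Hn1 : f n = L n * Rpower (INR n) (- al)) by (apply HfL; lia).
    rewrite (HfL m Hm), Hn1; unfold Rdiv at 2.
    rewrite <- Rpower_mult_distr by (trivial; now apply Rinv_0_lt_compat).
    replace (Rpower (/ INR n) (- al)) with (/ Rpower (INR n) (- al)).
    2:{ unfold Rpower; rewrite ln_Rinv, <- exp_Ropp by assumption; f_equal; ring. }
    assert (Hp : 0 < Rpower (INR n) (- al)) by apply exp_pos.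
    specialize (Hf n); rewrite Hn1 in Hf.
    field; split; [lra|]; intros E; rewrite E in Hf; lra.
  - apply (is_lim_seq_mult' _ _ 1 _); [now apply HL|].
    apply (is_lim_seq_continuous (fun x => Rpower x (- al))); [|apply is_lim_seq_div_ratio; lia].
    apply continuity_pt_filterlim, continuous_Rpower_l, Rdiv_lt_0_compat; assumption.
Qed.

(** This is Bernoulli's inequality. With [s = ln t], the bound [exp x >= 1 + x] is used at
    [(1 - al) s] and at [- al s]; in the average with weights [al] and [1 - al] the terms linear in
    [s] cancel. *)
Lemma Rpower_le_affine (t al : R) : 0 < t -> 0 <= al <= 1 -> Rpower t al <= 1 - al + al * t.
Proof.
  intros Ht Hal; unfold Rpower; set (s := ln t).
  assert (H1 : exp (al * s) * (1 + (1 - al) * s) <= t).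
  { rewrite <- (exp_ln t Ht) at 1; fold s.
    replace (exp s) with (exp (al * s) * exp ((1 - al) * s)) by (rewrite <- exp_plus; f_equal; ring).
    apply Rmult_le_compat_l; [left; apply exp_pos|apply exp_ineq1_le]. }
  assert (H2 : exp (al * s) * (1 - al * s) <= 1).
  { assert (E : exp (al * s) * exp (- (al * s)) = 1) by (rewrite <- exp_plus, Rplus_opp_r; apply exp_0).
    rewrite <- E; apply Rmult_le_compat_l; [left; apply exp_pos|].
    pose proof (exp_ineq1_le (- (al * s))); lra. }
  nra.
Qed.

Lemma Rpower_div_distr (x y al : R) :
  0 < x -> 0 < y -> Rpower (x / y) al = Rpower x al / Rpower y al.
Proof.
  intros Hx Hy; unfold Rpower; rewrite ln_div by assumption.
  unfold Rdiv; rewrite <- exp_Ropp, <- exp_plus; f_equal; ring.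
Qed.

(** Bernoulli's inequality at [t = (n + 1) / (n + 2)] has right-hand side [1 - al / (n + 2)],
    exactly the next factor of [binom_prod]. *)
Lemma binom_prod_Rpower_growing (al : R) (n : nat) :
  0 < al < 1 ->
  Rpower (INR (S n)) al * binom_prod al (S n) <= Rpower (INR (S (S n))) al * binom_prod al (S (S n)).
Proof.
  intros Hal; assert (H := INR_S_pos n); assert (H' := INR_S_pos (S n)).
  assert (HB := Rpower_le_affine (INR (S n) / INR (S (S n))) al
                  ltac:(now apply Rdiv_lt_0_compat) ltac:(lra)).
  rewrite Rpower_div_distr in HB by assumption.
  assert (Hp : 0 < Rpower (INR (S (S n))) al) by apply exp_pos.
  change (binom_prod al (S (S n))) with (binom_prod al (S n) * (1 - al / INR (S (S n)))).
  assert (Hb := binom_prod_pos al (S n) (proj2 Hal)); set (b := binom_prod al (S n)) in *.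
  rewrite (Rmult_comm _ (1 - al / INR (S (S n)))), <- Rmult_assoc.
  apply Rmult_le_compat_r; [lra|].
  apply Rmult_le_reg_r with (/ Rpower (INR (S (S n))) al); [now apply Rinv_0_lt_compat|].
  eapply Rle_trans; [exact HB|].
  apply Req_le; rewrite (S_INR (S n)) in *; field; lra.
Qed.

(** The left side decreases in [n]: Bernoulli's inequality at [t = (n + 2) / (n + 1)] bounds the
    growth of the power by [1 + x], with [x = al / (n + 1)], and [(1 + x) (1 - x) <= 1]. *)
Lemma binom_prod_Rpower_le_1 (al : R) (n : nat) :
  0 < al < 1 -> Rpower (INR (S n)) al * binom_prod al n <= 1.
Proof.
  intros Hal; induction n as [|n IH].
  - simpl; unfold Rpower; rewrite ln_1, Rmult_0_r, exp_0; lra.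
  - eapply Rle_trans; [|exact IH].
    assert (H := INR_S_pos n); assert (H' := INR_S_pos (S n)).
    assert (HB := Rpower_le_affine (INR (S (S n)) / INR (S n)) al
                    ltac:(now apply Rdiv_lt_0_compat) ltac:(lra)).
    rewrite Rpower_div_distr in HB by assumption.
    assert (Hp : 0 < Rpower (INR (S n)) al) by apply exp_pos.
    assert (Hb := binom_prod_pos al n (proj2 Hal)).
    cbn [binom_prod]; rewrite (Rmult_comm _ (1 - _)), <- Rmult_assoc.
    apply Rmult_le_compat_r; [lra|].
    set (x := al / INR (S n)).
    replace (1 - al + al * (INR (S (S n)) / INR (S n))) with (1 + x) in HB
      by (unfold x; rewrite (S_INR (S n)); field; lra).
    assert (Rpower (INR (S (S n))) al <= Rpower (INR (S n)) al * (1 + x)).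
    { apply Rmult_le_reg_r with (/ Rpower (INR (S n)) al); [now apply Rinv_0_lt_compat|].
      eapply Rle_trans; [exact HB|]; apply Req_le; field; lra. }
    assert (0 < 1 - x) by (apply binom_prod_factor_pos; lra).
    assert (0 < x) by (apply Rdiv_lt_0_compat; lra).
    nra.
Qed.

Lemma filterlim_mul_div (i M : nat) :
  (1 <= i)%nat -> (1 <= M)%nat ->
  filterlim (fun n => (i * n / M)%nat) eventually eventually.
Proof.
  intros Hi HM P [N HN]; exists (M * N)%nat; intros n Hn.
  apply HN, Nat.div_le_lower_bound; nia.
Qed.

(** The sequence [n ^ al * binom_prod al n] increases from [n = 1] on and is at most [1], so it has
    a positive limit and is therefore slowly varying. *)
Lemma regular_decreasing_binom_prod (al : R) :
  0 < al < 1 -> regular_decreasing al (binom_prod al).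
Proof.
  intros Hal; set (L := fun n => Rpower (INR n) al * binom_prod al n).
  assert (Hpos : forall n, 0 < L n)
    by (intros; apply Rmult_lt_0_compat; [apply exp_pos|apply binom_prod_pos; lra]).
  assert (Hinc : forall n, L (S n) <= L (S (S n))) by (intros; now apply binom_prod_Rpower_growing).
  assert (Hbd : forall n, L (S n) <= 1).
  { intros n; eapply Rle_trans; [|apply (binom_prod_Rpower_le_1 al (S n) Hal)].
    apply Rmult_le_compat_r; [left; apply binom_prod_pos; lra|].
    apply Rle_Rpower_l; [lra|]; split; [apply INR_S_pos|apply le_INR; lia]. }
  destruct (ex_finite_lim_seq_incr (fun n => L (S n)) 1 Hinc Hbd) as [l Hl].
  assert (0 < l).
  { apply Rlt_le_trans with (L 1%nat); [apply Hpos|].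
    apply (is_lim_seq_incr_compare (fun n => L (S n)) l Hl Hinc 0). }
  apply is_lim_seq_incr_1 in Hl.
  apply regular_decreasing_intro with L.
  - intros; apply binom_prod_pos; lra.
  - now apply binom_prod_decreasing.
  - intros n _; unfold L; rewrite Rpower_Ropp; field.
    apply Rgt_not_eq, exp_pos.
  - intros i M HiM; replace 1 with (l / l) by (field; lra).
    apply is_lim_seq_div'; [|assumption|lra].
    apply (is_lim_seq_subseq L); [apply filterlim_mul_div; lia|assumption].
Qed.

Lemma is_lim_seq_near (u : nat -> R) (l eps : R) :
  is_lim_seq u l -> 0 < eps -> eventually (fun n => Rabs (u n - l) < eps).
Proof. intros H Heps; exact (proj2 (is_lim_seq_spec u l) H (mkposreal eps Heps)). Qed.

Lemma eventually_forall_le (P : nat -> nat -> Prop) (M : nat) :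
  (forall i, (1 <= i <= M)%nat -> eventually (P i)) ->
  eventually (fun n => forall i, (1 <= i <= M)%nat -> P i n).
Proof.
  induction M as [|M IH]; intros H; [exists 0%nat; intros; lia|].
  destruct IH as [N1 H1]; [intros i Hi; apply H; lia|].
  destruct (H (S M) ltac:(lia)) as [N2 H2].
  exists (Nat.max N1 N2); intros n Hn i Hi.
  destruct (Nat.eq_dec i (S M)) as [->|Hne]; [apply H2|apply H1]; lia.
Qed.

Lemma sum_le_split (f : nat -> R) (h n : nat) :
  Un_decreasing f -> (h <= n)%nat ->
  sum_f_R0 f n <= sum_f_R0 f h + (INR n - INR h) * f h.
Proof.
  intros Hf Hh; rewrite <- minus_INR by assumption.
  enough (sum_f_R0 f (h + (n - h)) - sum_f_R0 f h <= INR (n - h) * f h) as H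
    by (replace (h + (n - h))%nat with n in H by lia; lra).
  apply increment_le; intros i Hi; rewrite tech5.
  assert (f (S i) <= f h) by (apply decreasing_prop; [assumption|lia]); lra.
Qed.

(** Covers the finitely many indices below the threshold at which the halving argument starts. *)
Lemma sum_le_initial (f : nat -> R) (N : nat) :
  (forall n, 0 < f n) ->
  exists C, 0 <= C /\ forall n, (1 <= n <= N)%nat -> sum_f_R0 f n <= C * (INR n * f n).
Proof.
  intros Hf; induction N as [|N [C [HC IH]]]; [exists 0; split; [lra|intros; lia]|].
  set (d := INR (S N) * f (S N)).
  assert (Hd : 0 < d) by (apply Rmult_lt_0_compat; [apply INR_S_pos|apply Hf]).
  assert (HS : 0 <= sum_f_R0 f (S N) / d).
  { apply Rdiv_le_0_compat; [|assumption]; apply cond_pos_sum; intros; left; apply Hf. }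
  exists (C + sum_f_R0 f (S N) / d); split; [lra|]; intros n Hn.
  assert (Hn0 : 0 < INR n * f n) by (apply Rmult_lt_0_compat; [apply lt_0_INR; lia|apply Hf]).
  destruct (Nat.eq_dec n (S N)) as [->|Hne].
  - fold d; replace ((C + sum_f_R0 f (S N) / d) * d) with (C * d + sum_f_R0 f (S N)) by (field; lra).
    nra.
  - specialize (IH n ltac:(lia)); nra.
Qed.

(* Since [f (n / 2) <= kappa * f n] eventually with [kappa < 2], halving [n] gives
   [sum f n <= kappa * (C / 2 + 1) * n * f n] from the bound for [n / 2]. *)
Lemma regular_decreasing_sum_le (al : R) (f : nat -> R) :
  0 < al < 1 -> regular_decreasing al f ->
  exists C, 0 <= C /\ forall n, (1 <= n)%nat -> sum_f_R0 f n <= C * (INR n * f n).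
Proof.
  intros Hal [Hf [Hd Hr]].
  set (t := Rpower (INR 1 / INR 2) (- al)).
  assert (Ht : 0 < t < 2).
  { split; [apply exp_pos|]; unfold t.
    replace (INR 1 / INR 2) with (/ 2) by (simpl; field).
    replace (Rpower (/ 2) (- al)) with (Rpower 2 al)
      by (unfold Rpower; rewrite ln_Rinv by lra; f_equal; ring).
    rewrite <- (Rpower_1 2) at 2 by lra; apply Rpower_lt; lra. }
  destruct (is_lim_seq_near _ _ ((2 - t) / 2) (Hr 1%nat 2%nat ltac:(lia)) ltac:(lra)) as [N HN].
  fold t in HN; set (kappa := t + (2 - t) / 2).
  assert (Hk : 0 < kappa < 2) by (unfold kappa; lra).
  destruct (sum_le_initial f (Nat.max N 1) Hf) as [C1 [HC1 Hinit]].
  (* The halving step reproduces its constant when [kappa * (C / 2 + 1) <= C], that is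
     [C * (2 - kappa) >= 2 * kappa]. *)
  set (C := C1 + 2 * kappa / (2 - kappa)).
  assert (HC : C1 <= C /\ kappa * (C / 2 + 1) <= C).
  { assert (0 < 2 * kappa / (2 - kappa)) by (apply Rdiv_lt_0_compat; lra).
    split; [unfold C; lra|].
    assert (C * (2 - kappa) = C1 * (2 - kappa) + 2 * kappa) by (unfold C; field; lra).
    nra. }
  exists C; split; [lra|].
  induction n as [n IH] using lt_wf_ind; intros Hn.
  assert (Hn0 : 0 < INR n) by (apply lt_0_INR; lia); assert (Hfn := Hf n).
  destruct (Nat.le_gt_cases n (Nat.max N 1)) as [Hle|Hgt].
  - eapply Rle_trans; [apply Hinit; lia|]; apply Rmult_le_compat_r; nra.
  - assert (Hh := div_ge_1 1 2 n ltac:(lia) ltac:(lia)).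
    assert (Hh2 := INR_div_bounds (1 * n) 2 ltac:(lia)).
    specialize (HN n ltac:(lia)); set (h := (1 * n / 2)%nat) in *.
    rewrite mult_INR in Hh2; simpl (INR 1) in Hh2; change (INR 2) with 2 in Hh2.
    assert (Hhn : (h < n)%nat) by (apply INR_lt; lra).
    specialize (IH h Hhn Hh); apply Rabs_def2 in HN.
    assert (Hfh : f h <= kappa * f n).
    { apply Rmult_le_reg_r with (/ f n); [now apply Rinv_0_lt_compat|].
      rewrite Rmult_assoc, Rinv_r by lra; unfold kappa, Rdiv in *; lra. }
    assert (Hfh0 := Hf h); assert (Hh0 := pos_INR h).
    apply Rle_trans with ((C / 2 + 1) * INR n * f h).
    + assert (C * (INR h * f h) <= C * (INR n / 2 * f h))
        by (apply Rmult_le_compat_l; [lra|]; apply Rmult_le_compat_r; lra).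
      assert (0 <= INR h * f h) by (apply Rmult_le_pos; lra).
      eapply Rle_trans; [apply (sum_le_split f h n Hd); lia|]; lra.
    + apply Rle_trans with ((C / 2 + 1) * INR n * (kappa * f n)).
      2:{ assert (0 <= INR n * f n) by (apply Rmult_le_pos; lra).
          assert (kappa * (C / 2 + 1) * (INR n * f n) <= C * (INR n * f n))
            by (apply Rmult_le_compat_r; tauto); lra. }
      apply Rmult_le_compat_l; [nra|assumption].
Qed.

(** * Comparison in mean of two sequences of the same index *)

Definition ratio_distance (f g : nat -> R) (N n : nat) : R :=
  sum_f_R0 (fun j => Rabs (f j / f N - g j / g N)) n.

Lemma decreasing_div_le (f : nat -> R) (m n N : nat) :
  (forall n, 0 < f n) -> Un_decreasing f -> (m <= n)%nat -> f n / f N <= f m / f N.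
Proof.
  intros Hf Hd Hmn; apply Rmult_le_compat_r; [left; apply Rinv_0_lt_compat, Hf|].
  now apply decreasing_prop.
Qed.

(** On the block between [i * N / M] and [S i * N / M], monotonicity keeps both ratios between
    [X (S i) - eta] and [X i + eta], so they differ by at most [X i - X (S i) + 2 * eta]. A block
    has at most [N / M + 1] indices, and the differences of [X] telescope. *)
Lemma ratio_distance_blocks (f g X : nat -> R) (eta : R) (M N : nat) :
  (forall n, 0 < f n) -> Un_decreasing f -> (forall n, 0 < g n) -> Un_decreasing g ->
  (forall i, (1 <= i <= M)%nat -> Rabs (f (i * N / M)%nat / f N - X i) < eta
                              /\ Rabs (g (i * N / M)%nat / g N - X i) < eta) ->
  forall i, (1 <= i <= M)%nat ->
    ratio_distance f g N (i * N / M)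
    <= ratio_distance f g N (1 * N / M)
       + (INR N / INR M + 1) * (X 1%nat - X i + 2 * INR i * eta).
Proof.
  intros Hf Hdf Hg Hdg HX; induction i as [|i IH]; intros Hi; [lia|].
  assert (HM : 0 < INR M) by (apply lt_0_INR; lia).
  assert (HNM : 0 <= INR N / INR M) by (apply Rdiv_le_0_compat; [apply pos_INR|assumption]).
  destruct (Nat.eq_dec i 0) as [->|Hi0].
  { destruct (HX 1%nat Hi) as [H _]; assert (0 < eta) by (pose proof (Rabs_pos (f (1 * N / M)%nat / f N - X 1%nat)); lra).
    simpl (INR 1); nra. }
  specialize (IH ltac:(lia)).
  destruct (HX i ltac:(lia)) as [HXf HXg]; destruct (HX (S i) Hi) as [HXf' HXg'].
  apply Rabs_def2 in HXf, HXg, HXf', HXg'.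
  assert (Hb := INR_div_bounds (i * N) M ltac:(lia)).
  assert (Hb' := INR_div_bounds (S i * N) M ltac:(lia)).
  rewrite mult_INR in Hb, Hb'; rewrite S_INR in Hb'.
  assert (Hle : (i * N / M <= S i * N / M)%nat) by (apply Nat.Div0.div_le_mono; lia).
  set (m := (i * N / M)%nat) in *; set (m' := (S i * N / M)%nat) in *.
  assert (Hff := decreasing_div_le f m m' N Hf Hdf Hle).
  set (c := X i - X (S i) + 2 * eta).
  assert (Hinc : ratio_distance f g N (m + (m' - m)) - ratio_distance f g N m
                 <= INR (m' - m) * c).
  { apply increment_le; intros j Hj; unfold ratio_distance; rewrite tech5.
    assert (H1 := decreasing_div_le f m (S j) N Hf Hdf ltac:(lia)).
    assert (H2 := decreasing_div_le f (S j) m' N Hf Hdf ltac:(lia)).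
    assert (H3 := decreasing_div_le g m (S j) N Hg Hdg ltac:(lia)).
    assert (H4 := decreasing_div_le g (S j) m' N Hg Hdg ltac:(lia)).
    enough (Rabs (f (S j) / f N - g (S j) / g N) <= c) by lra.
    apply Rabs_le; unfold c; lra. }
  replace (m + (m' - m))%nat with m' in Hinc by lia.
  rewrite minus_INR in Hinc by assumption.
  assert (0 <= c) by (unfold c; lra).
  assert (INR m' - INR m <= INR N / INR M + 1).
  { replace ((INR i + 1) * INR N / INR M) with (INR i * INR N / INR M + INR N / INR M) in Hb'
      by (field; lra); lra. }
  assert ((INR m' - INR m) * c <= (INR N / INR M + 1) * c) by (apply Rmult_le_compat_r; assumption).
  rewrite S_INR; unfold c in *; lra.
Qed.

Lemma ratio_distance_le_sums (f g : nat -> R) (N n : nat) :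
  (forall n, 0 < f n) -> (forall n, 0 < g n) ->
  ratio_distance f g N n <= sum_f_R0 f n / f N + sum_f_R0 g n / g N.
Proof.
  intros Hf Hg; unfold Rdiv; rewrite !(Rmult_comm (sum_f_R0 _ _)), !scal_sum, <- plus_sum.
  apply sum_Rle; intros j _.
  assert (0 < f j * / f N) by (apply Rdiv_lt_0_compat; apply Hf).
  assert (0 < g j * / g N) by (apply Rdiv_lt_0_compat; apply Hg).
  apply Rabs_le; unfold Rdiv; lra.
Qed.

Lemma Rpower_sublinear (al K eps : R) :
  al < 1 -> 0 < K -> 0 < eps ->
  exists M, (1 <= M)%nat /\ K * Rpower (INR M) al <= eps * INR M.
Proof.
  intros Hal HK Heps; set (y := Rpower (K / eps) (/ (1 - al))).
  destruct (INR_unbounded y) as [M HM].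
  assert (Hy : 0 < y) by apply exp_pos.
  assert (HM1 : (1 <= M)%nat) by (destruct M; [simpl in HM; lra|lia]).
  assert (HM0 : 0 < INR M) by lra.
  exists M; split; [assumption|].
  assert (H : K / eps <= Rpower (INR M) (1 - al)).
  { rewrite <- (Rpower_1 (K / eps)) by (now apply Rdiv_lt_0_compat).
    replace 1 with (/ (1 - al) * (1 - al)) at 1 by (field; lra).
    rewrite <- Rpower_mult; fold y; apply Rle_Rpower_l; lra. }
  rewrite <- (Rpower_1 (INR M)) at 2 by assumption.
  replace 1 with (al + (1 - al)) at 1 by ring; rewrite Rpower_plus.
  assert (Hp : 0 < Rpower (INR M) al) by apply exp_pos.
  apply Rmult_le_compat_r with (r := eps) in H; [|lra].
  replace (K / eps * eps) with K in H by (field; lra); nra.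
Qed.

(** The indices up to [N / M] contribute a multiple of [(N / M) * M ^ al], by the bound on sums. The
    remaining blocks contribute a similar amount, as [X 1 = M ^ al]. Since [al < 1], the total is at
    most [eps * N] for a suitable [M]. *)
Lemma regular_decreasing_ratio_distance (al : R) (f g : nat -> R) (eps : R) :
  0 < al < 1 -> regular_decreasing al f -> regular_decreasing al g -> 0 < eps ->
  eventually (fun N => ratio_distance f g N N <= eps * INR N).
Proof.
  intros Hal Hrf Hrg Heps.
  destruct (regular_decreasing_sum_le al f Hal Hrf) as [Cf [HCf HSf]].
  destruct (regular_decreasing_sum_le al g Hal Hrg) as [Cg [HCg HSg]].
  destruct Hrf as [Hf [Hdf Hrf]]; destruct Hrg as [Hg [Hdg Hrg]].
  set (C := Cf + Cg).
  (* With [T = M ^ al >= 1] and [x = N / M >= 1], the head is at most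
     [x * C * (T + 1) <= 2 * C * x * T], and the blocks, with [eta = 1 / M], at most
     [2 * x * (T + 2) <= 6 * x * T]. *)
  destruct (Rpower_sublinear al (2 * C + 6) eps) as [M [HM HMeps]]; [lra|unfold C; lra|assumption|].
  assert (HM0 : 1 <= INR M) by (change 1 with (INR 1); now apply le_INR).
  set (X := fun i => Rpower (INR i / INR M) (- al)).
  assert (Heta : 0 < / INR M <= 1).
  { split; [apply Rinv_0_lt_compat; lra|].
    rewrite <- Rinv_1; apply Rinv_le_contravar; lra. }
  assert (HX : eventually (fun N => forall i, (1 <= i <= M)%nat ->
     Rabs (f (i * N / M)%nat / f N - X i) < / INR M /\ Rabs (g (i * N / M)%nat / g N - X i) < / INR M)).
  { apply eventually_forall_le; intros i Hi.
    apply (filter_and (F := eventually)); apply is_lim_seq_near; try tauto; [now apply Hrf|now apply Hrg]. }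
  destruct HX as [N0 HX]; exists (Nat.max N0 M); intros N HN.
  specialize (HX N ltac:(lia)).
  assert (Hblocks := ratio_distance_blocks f g X (/ INR M) M N Hf Hdf Hg Hdg HX M ltac:(lia)).
  rewrite (Nat.mul_comm M N), Nat.div_mul in Hblocks by lia.
  destruct (HX 1%nat ltac:(lia)) as [HXf HXg]; apply Rabs_def2 in HXf, HXg.
  assert (Hn1 := div_ge_1 1 M N ltac:(lia) ltac:(lia)).
  assert (Hb := proj2 (INR_div_bounds (1 * N) M ltac:(lia))).
  rewrite Nat.mul_1_l in *.
  set (n1 := (N / M)%nat) in *.
  assert (HXM : 0 < X M) by apply exp_pos.
  set (T := Rpower (INR M) al) in *.
  assert (HX1 : X 1%nat = T).
  { unfold X, T, Rpower; simpl (INR 1); unfold Rdiv; rewrite Rmult_1_l, ln_Rinv by lra.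
    f_equal; ring. }
  assert (HT : 1 <= T).
  { unfold T; rewrite <- (Rpower_O (INR M)) by lra; apply Rle_Rpower; lra. }
  rewrite HX1 in *.
  set (x := INR N / INR M) in *.
  assert (HNM : INR M <= INR N) by (apply le_INR; lia).
  assert (Hx1 : 1 <= x) by (apply Rmult_le_reg_r with (INR M); unfold x; field_simplify; lra).
  assert (Hn10 := pos_INR n1).
  assert (Hhead : ratio_distance f g N n1 <= x * (C * (T + 1))).
  { eapply Rle_trans; [now apply ratio_distance_le_sums|].
    assert (Hhf : sum_f_R0 f n1 / f N <= Cf * INR n1 * (f n1 / f N)).
    { apply Rle_trans with (Cf * (INR n1 * f n1) / f N); [|unfold Rdiv; lra].
      apply Rmult_le_compat_r; [left; apply Rinv_0_lt_compat, Hf|now apply HSf]. }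
    assert (Hhg : sum_f_R0 g n1 / g N <= Cg * INR n1 * (g n1 / g N)).
    { apply Rle_trans with (Cg * (INR n1 * g n1) / g N); [|unfold Rdiv; lra].
      apply Rmult_le_compat_r; [left; apply Rinv_0_lt_compat, Hg|now apply HSg]. }
    assert (Cf * INR n1 * (f n1 / f N) <= Cf * x * (T + 1)).
    { apply Rmult_le_compat; [nra|left; now apply Rdiv_lt_0_compat|nra|lra]. }
    assert (Cg * INR n1 * (g n1 / g N) <= Cg * x * (T + 1)).
    { apply Rmult_le_compat; [nra|left; now apply Rdiv_lt_0_compat|nra|lra]. }
    unfold C; lra. }
  replace (2 * INR M * / INR M) with 2 in Hblocks by (field; lra).
  apply Rle_trans with (x * ((2 * C + 6) * T)).
  - assert ((x + 1) * (T - X M + 2) <= 2 * x * (T + 2)).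
    { apply Rle_trans with ((x + 1) * (T + 2)); nra. }
    assert (x * (C * (T + 1)) <= x * (C * (2 * T))).
    { apply Rmult_le_compat_l; [lra|]; apply Rmult_le_compat_l; unfold C; lra. }
    nra.
  - apply Rmult_le_reg_r with (INR M); [lra|].
    replace (x * ((2 * C + 6) * T) * INR M) with (INR N * ((2 * C + 6) * T))
      by (unfold x; field; lra).
    rewrite (Rmult_comm eps), Rmult_assoc; apply Rmult_le_compat_l; [apply pos_INR|assumption].
Qed.

(** * Inverses for the convolution *)

(** Log-convexity makes the ratios [f (S n) / f n] nondecreasing; denominators are cleared. *)
Lemma log_convex_ratio (f : nat -> R) (a b : nat) :
  (forall n, 0 < f n) -> (forall n, f (S n) ^ 2 <= f n * f (S (S n))) -> (a <= b)%nat ->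
  f (S a) * f b <= f a * f (S b).
Proof.
  intros Hf Hc Hab; induction Hab as [|b _ IH]; [lra|].
  apply Rmult_le_reg_r with (f b); [apply Hf|].
  assert (Ha := Hf a); assert (HSb := Hf (S b)); specialize (Hc b).
  apply Rle_trans with (f a * f (S b) ^ 2); [nra|].
  apply Rmult_le_compat_l with (r := f a) in Hc; lra.
Qed.

(* Kaluza's argument: with [d n = r (S n) - r n], eliminating the leading terms between
   two consecutive instances of [f (S n) + sum d j * f (n - j) = 0] expresses [d (S n)] as a
   combination of [d 0 ... d n] with nonnegative weights. *)
Lemma kaluza_decreasing (f r : nat -> R) :
  (forall n, 0 < f n) -> (forall n, f (S n) ^ 2 <= f n * f (S (S n))) -> f O = 1 ->
  (forall n, conv f r n = 1) -> Un_decreasing r.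
Proof.
  intros Hf Hc Hf0 Hr; set (d := fun n => r (S n) - r n).
  assert (Hr0 : r O = 1) by (generalize (Hr O); unfold conv; simpl; rewrite Hf0; lra).
  assert (Hd : forall n, f (S n) + sum_f_R0 (fun j => d j * f (n - j)%nat) n = 0).
  { intros n; assert (E := Hr (S n)); rewrite <- (Hr n), !(conv_comm f r) in E.
    unfold conv in E; rewrite decomp_sum, Hr0, Nat.sub_0_r in E by lia; simpl Nat.pred in E.
    rewrite (sum_eq (fun j => d j * f (n - j)%nat) (fun j => r (S j) * f (n - j)%nat - r j * f (n - j)%nat))
      by (intros; unfold d; ring).
    rewrite minus_sum.
    rewrite (sum_eq (fun i => r (S i) * f (S n - S i)%nat) (fun j => r (S j) * f (n - j)%nat)) in E
      by (intros; f_equal; f_equal; lia).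
    lra. }
  enough (H : forall n, d n <= 0) by (intros n; specialize (H n); unfold d in H; lra).
  induction n as [n IH] using lt_wf_ind.
  destruct n as [|n].
  - generalize (Hd O) (Hf 1%nat); simpl; rewrite Hf0; lra.
  - assert (E := Hd (S n)); rewrite tech5, Nat.sub_diag, Hf0 in E; assert (E' := Hd n).
    (* The ratio inequality compares the weights term by term; its direction is reversed because
       [d j <= 0]. *)
    assert (Hs : f (S (S n)) * sum_f_R0 (fun j => d j * f (n - j)%nat) n
                 <= f (S n) * sum_f_R0 (fun j => d j * f (S n - j)%nat) n).
    { rewrite !scal_sum; apply sum_Rle; intros j Hj.
      assert (HL := log_convex_ratio f (n - j) (S n) Hf Hc ltac:(lia)).
      rewrite (Nat.sub_succ_l j n Hj); specialize (IH j ltac:(lia)); nra. }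
    assert (HS := Hf (S n)); apply Rmult_le_reg_l with (f (S n)); [assumption|].
    replace (sum_f_R0 (fun j => d j * f (n - j)%nat) n) with (- f (S n)) in Hs by lra.
    replace (sum_f_R0 (fun j => d j * f (S n - j)%nat) n) with (- f (S (S n)) - d (S n)) in Hs by lra.
    lra.
Qed.

(** If [r m < 0], then in the convolution at [m + N] the terms beyond [m] are nonpositive, and the
    first [m + 1] terms are each at most [f N < 1 / (m + 1)] for a suitable [N]. The convolution
    would be less than [1]. *)
Lemma conv_inverse_nonneg (f r : nat -> R) :
  (forall n, 0 < f n) -> Un_decreasing f -> is_lim_seq f 0 -> f O = 1 ->
  (forall n, conv f r n = 1) -> Un_decreasing r -> forall n, 0 <= r n.
Proof.
  intros Hf Hd Hlim Hf0 Hr Hrd m.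
  destruct (Rle_lt_dec 0 (r m)) as [|Hneg]; [assumption|exfalso].
  assert (Hr0 : r O = 1) by (generalize (Hr O); unfold conv; simpl; rewrite Hf0; lra).
  assert (HSm := INR_S_pos m).
  destruct (is_lim_seq_near f 0 (/ INR (S m)) Hlim ltac:(now apply Rinv_0_lt_compat)) as [N HN].
  specialize (HN N (le_n N)); rewrite Rminus_0_r, Rabs_pos_eq in HN by (left; apply Hf).
  assert (E := Hr (m + N)%nat); rewrite conv_comm in E; unfold conv in E.
  set (h := fun j => r j * f (m + N - j)%nat) in E.
  assert (H1 : sum_f_R0 h (m + N) - sum_f_R0 h m <= INR N * 0).
  { apply increment_le; intros i Hi; rewrite tech5; unfold h.
    assert (r (S i) <= r m) by (apply decreasing_prop; [assumption|lia]).
    specialize (Hf (m + N - S i)%nat); nra. }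
  assert (H2 : sum_f_R0 h m <= sum_f_R0 (fun _ => f N) m).
  { apply sum_Rle; intros j Hj; unfold h.
    assert (r j <= r O) by (apply decreasing_prop; [assumption|lia]).
    assert (f (m + N - j)%nat <= f N) by (apply decreasing_prop; [assumption|lia]).
    specialize (Hf (m + N - j)%nat); nra. }
  rewrite sum_cte in H2.
  apply Rmult_lt_compat_r with (r := INR (S m)) in HN; [|assumption].
  rewrite Rinv_l in HN by lra; lra.
Qed.

(** * Comparison of two convolution inverses *)

Section Comparison.

Variables (f r p q : nat -> R) (N : nat).
Hypotheses (Hf : forall n, 0 < f n) (Hdf : Un_decreasing f) (Hr : forall n, 0 <= r n)
  (Hp : forall n, 0 < p n) (Hdp : Un_decreasing p) (Hq : forall n, 0 <= q n)
  (Hfr : forall n, conv f r n = 1) (Hpq : forall n, conv p q n = 1).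

(* Writing [p / p N = f / f N - mu] and convolving [f * r = 1] with [q], the inverse of [p],
   gives [(f N / p N) (r * 1) = q * 1 - f N (mu * r * q)]. *)
Lemma conv_inverse_comparison (n : nat) :
  f N / p N * sum_f_R0 r n
  = sum_f_R0 q n - f N * conv (conv (fun j => f j / f N - p j / p N) r) q n.
Proof.
  assert (HfN := Hf N); assert (HpN := Hp N).
  set (mu := fun j => f j / f N - p j / p N).
  assert (E1 : conv (conv p r) q n = sum_f_R0 r n).
  { rewrite <- conv_1_r, (conv_ext _ (conv r p) q q) by (intros; trivial; apply conv_comm).
    rewrite conv_assoc; apply conv_ext; intros; trivial. }
  assert (E2 : conv (conv p r) q n
    = p N / f N * sum_f_R0 q n + - p N * conv (conv mu r) q n).
  { rewrite <- (conv_1_l q), <- conv_lin_l; apply conv_ext; [|trivial]; intros j _.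
    rewrite <- (Hfr j), <- conv_lin_l; apply conv_ext; [|trivial]; intros i _.
    unfold mu; field; lra. }
  rewrite <- E1, E2; field; lra.
Qed.

(** The identity for single sums has an error that is controlled only in l1 norm, so one more
    summation gives a uniform bound. The factor [f N] absorbs the sum of [r], because
    [f N * sum_f_R0 r N <= 1]. *)
Lemma sum_sum_comparison (n : nat) :
  (n <= N)%nat ->
  Rabs (f N / p N * sum_sum r n - sum_sum q n) <= sum_f_R0 q N * ratio_distance f p N N.
Proof.
  intros Hn; assert (HfN := Hf N).
  set (mu := fun j => f j / f N - p j / p N).
  unfold sum_sum; rewrite scal_sum, <- minus_sum.
  eapply Rle_trans; [apply Rsum_abs|].
  apply Rle_trans with (sum_f_R0 (fun j => Rabs (conv (conv mu r) q j) * f N) n).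
  { apply Req_le, sum_eq; intros j _.
    rewrite (Rmult_comm _ (f N / p N)), conv_inverse_comparison; fold mu.
    replace (sum_f_R0 q j - f N * conv (conv mu r) q j - sum_f_R0 q j)
      with (- (conv (conv mu r) q j * f N)) by ring.
    rewrite Rabs_Ropp, Rabs_mult, (Rabs_pos_eq (f N)) by lra; reflexivity. }
  rewrite <- scal_sum.
  assert (Hq0 : 0 <= sum_f_R0 q N) by (now apply cond_pos_sum).
  assert (Habs : forall u, (forall j, 0 <= u j) -> sum_f_R0 (fun j => Rabs (u j)) N = sum_f_R0 u N)
    by (intros u Hu; apply sum_eq; intros; now apply Rabs_pos_eq).
  assert (H1 : sum_f_R0 (fun j => Rabs (conv (conv mu r) q j)) n
               <= ratio_distance f p N N * sum_f_R0 r N * sum_f_R0 q N).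
  { eapply Rle_trans; [apply sum_increasing with (n := N); [intros; apply Rabs_pos|assumption]|].
    eapply Rle_trans; [apply sum_abs_conv|]; rewrite (Habs q) by assumption.
    apply Rmult_le_compat_r; [assumption|].
    eapply Rle_trans; [apply sum_abs_conv|]; rewrite (Habs r) by assumption; apply Rle_refl. }
  assert (H2 : f N * sum_f_R0 r N <= 1) by (now apply sum_le_inv_of_conv).
  assert (H0 : 0 <= ratio_distance f p N N * sum_f_R0 q N)
    by (apply Rmult_le_pos; [apply cond_pos_sum; intros; apply Rabs_pos|assumption]).
  apply Rmult_le_compat_l with (r := f N) in H1; [|lra].
  apply Rmult_le_compat_r with (r := ratio_distance f p N N * sum_f_R0 q N) in H2; [|assumption].
  lra.
Qed.

Hypotheses (Hdr : Un_decreasing r) (Hdq : Un_decreasing q).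

(** Second differences with step [m] of the previous estimate are taken and multiplied by [p N],
    which absorbs the sum of [q]. The factor [4] is the sum of the absolute values of the
    coefficients [1], [-2], [1]. *)
Lemma window_comparison (n m : nat) :
  N = (n + m + m)%nat ->
  INR m ^ 2 * (f N * r N) <= INR m ^ 2 * (p N * q n) + 4 * ratio_distance f p N N /\
  INR m ^ 2 * (p N * q N) <= INR m ^ 2 * (f N * r n) + 4 * ratio_distance f p N N.
Proof.
  intros HN; assert (HfN := Hf N); assert (HpN := Hp N).
  set (E := ratio_distance f p N N); set (Q := sum_f_R0 q N).
  assert (HE : 0 <= E) by (apply cond_pos_sum; intros; apply Rabs_pos).
  assert (HQ : p N * Q <= 1) by (now apply sum_le_inv_of_conv).
  assert (C0 := sum_sum_comparison n ltac:(lia)).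
  assert (C1 := sum_sum_comparison (n + m) ltac:(lia)).
  assert (C2 := sum_sum_comparison (n + m + m) ltac:(lia)).
  assert (R1 := second_difference_le r n m Hdr); assert (R2 := second_difference_ge r n m Hdr).
  assert (Q1 := second_difference_le q n m Hdq); assert (Q2 := second_difference_ge q n m Hdq).
  rewrite <- HN in *; fold E Q in C0, C1, C2.
  apply Rabs_le_between in C0, C1, C2.
  set (c := f N / p N) in *.
  assert (Hc : 0 < c) by (now apply Rdiv_lt_0_compat).
  apply Rmult_le_compat_l with (r := c) in R1, R2; [|lra|lra].
  assert (H1 : INR m ^ 2 * (c * r N) <= INR m ^ 2 * q n + 4 * (Q * E)) by lra.
  assert (H2 : INR m ^ 2 * q N <= INR m ^ 2 * (c * r n) + 4 * (Q * E)) by lra.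
  apply Rmult_le_compat_l with (r := p N) in H1, H2; [|lra|lra].
  assert (Hpc : p N * c = f N) by (unfold c; field; lra).
  apply Rmult_le_compat_r with (r := E) in HQ; [|assumption].
  rewrite <- Hpc; split; lra.
Qed.

End Comparison.

Theorem conv_inverse_asymptotics (al : R) (f r : nat -> R) :
  0 < al < 1 -> regular_decreasing al f -> Un_decreasing r -> (forall n, 0 <= r n) ->
  (forall n, conv f r n = 1) ->
  is_lim_seq (fun n => INR n * f n * r n) (sin (al * PI) / PI).
Proof.
  intros Hal Hreg Hdr Hr Hfr.
  set (p := binom_prod al); set (q := binom_prod (1 - al)); set (c := sin (al * PI) / PI).
  assert (Hp : forall n, 0 < p n) by (intros; apply binom_prod_pos; lra).
  assert (Hq : forall n, 0 < q n) by (intros; apply binom_prod_pos; lra).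
  assert (Hdp : Un_decreasing p) by (now apply binom_prod_decreasing).
  assert (Hdq : Un_decreasing q) by (apply binom_prod_decreasing; lra).
  assert (Hpq : forall n, conv p q n = 1) by (intros; apply conv_binom_prod).
  assert (Hlim := is_lim_seq_INR_binom_prod al Hal); fold p q c in Hlim.
  destruct Hreg as [Hf [Hdf Hreg]].
  apply is_lim_seq_spec; intros [eta Heta]; simpl pos.
  assert (Hc : -1 <= c).
  { pose proof PI_RGT_0; pose proof PI2_1; pose proof (SIN_bound (al * PI)).
    apply Rmult_le_reg_r with PI; trivial; unfold c; field_simplify; lra. }
  (* A window has relative length about [2 / M]. The choice of [M] makes
     [t * (c + 1 + eta) <= eta / 2], where [1 + t = M / (M - 2)] bounds the ratio of the ends of a
     window. *)
  destruct (INR_unbounded (4 + 4 * (c + 1 + eta) / eta)) as [M HM].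
  assert (HM4 : 4 < INR M).
  { assert (0 <= 4 * (c + 1 + eta) / eta) by (apply Rdiv_le_0_compat; lra); lra. }
  set (t := 2 / (INR M - 2)).
  assert (Ht : 0 < t) by (apply Rdiv_lt_0_compat; lra).
  assert (HtM : t * (INR M - 2) = 2) by (unfold t; field; lra).
  assert (Hteta : 2 * (t * (c + 1 + eta)) <= eta).
  { apply Rmult_le_reg_r with (INR M - 2); [lra|].
    replace (2 * (t * (c + 1 + eta)) * (INR M - 2)) with (2 * (t * (INR M - 2)) * (c + 1 + eta)) by ring.
    rewrite HtM.
    assert (4 * (c + 1 + eta) / eta * eta = 4 * (c + 1 + eta)) by (field; lra).
    assert (4 * (c + 1 + eta) / eta * eta <= (INR M - 2) * eta)
      by (apply Rmult_le_compat_r; lra).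
    lra. }
  (* [36 = 4 * 9]: the error carries a factor [4], and [N <= 3 * m * M] in the worse of the two
     windows below. The choice of [delta] then makes [delta + K * delta = eta / 4]. *)
  set (K := 36 * INR M ^ 2); assert (HK : 0 < K) by (unfold K; nra).
  set (delta := eta / (4 * (1 + K))).
  assert (Hdelta : 0 < delta) by (apply Rdiv_lt_0_compat; lra).
  assert (HdeltaK : 4 * (delta + K * delta) = eta) by (unfold delta; field; lra).
  assert (HKdelta : 0 < K * delta) by (apply Rmult_lt_0_compat; lra).
  destruct (is_lim_seq_near _ _ delta Hlim Hdelta) as [N1 H1].
  destruct (regular_decreasing_ratio_distance al f p delta Hal
              (conj Hf (conj Hdf Hreg)) (regular_decreasing_binom_prod al Hal) Hdelta) as [N2 H2].
  assert (Hwin := fun N n m => window_comparison f r p q N Hf Hdf Hr Hp Hdp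
                    (fun n => Rlt_le _ _ (Hq n)) Hfr Hpq Hdr Hdq n m).
  (* For the upper bound the window ends at the given index [N]. The threshold ensures that its
     start [n] is at least [N / 2], hence at least [N1], and that [m >= x / 2]. *)
  assert (Hupper : forall N, (2 * (N1 + N2 + M) <= N)%nat -> INR N * f N * r N < c + eta).
  { intros N HN.
    assert (HMp : (0 < M)%nat) by (apply INR_lt; simpl; lra).
    assert (Hm := INR_div_bounds N M HMp); set (m := (N / M)%nat) in *.
    assert (Hmn : (2 * m <= N)%nat).
    { assert (2 <= M)%nat by (apply INR_le; simpl; lra).
      pose proof (Nat.Div0.mul_div_le N M); unfold m; nia. }
    set (n := (N - 2 * m)%nat); assert (HNn : N = (n + m + m)%nat) by (unfold n; lia).
    destruct (Hwin N n m HNn) as [HW _]; specialize (H2 N ltac:(lia)).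
    assert (HNR : INR N = INR n + 2 * INR m) by (rewrite HNn, !plus_INR; ring).
    set (x := INR N / INR M) in *.
    assert (HxM : x * INR M = INR N) by (unfold x; field; lra).
    assert (HNM : 2 * INR M <= INR N)
      by (change 2 with (INR 2); rewrite <- mult_INR; apply le_INR; lia).
    assert (Hx : 2 <= x) by (apply Rmult_le_reg_r with (INR M); lra).
    assert (Hm0 : x <= 2 * INR m) by lra.
    assert (HnN : INR N <= (1 + t) * INR n).
    { apply Rle_trans with ((1 + t) * (INR N - 2 * x)); [|apply Rmult_le_compat_l; lra].
      apply Req_le; rewrite <- HxM; unfold t; field; lra. }
    assert (Hn1 : (N1 <= n)%nat).
    { apply INR_le; assert (INR (2 * (N1 + N2 + M)) <= INR N) by (now apply le_INR).
      rewrite mult_INR, !plus_INR in *; change (INR 2) with 2 in *.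
      pose proof (pos_INR N1); pose proof (pos_INR N2). nra. }
    specialize (H1 n Hn1); apply Rabs_def2 in H1.
    assert (Hpn : p N <= p n) by (apply decreasing_prop; [assumption|lia]).
    assert (Hqn := Hq n); assert (HpN := Hp N); assert (Hn0 := pos_INR n).
    assert (HNx : INR N * (p N * q n) <= (1 + t) * (c + delta)).
    { apply Rle_trans with ((1 + t) * INR n * (p n * q n)).
      - apply Rmult_le_compat; [lra|nra|assumption|apply Rmult_le_compat_r; lra].
      - rewrite Rmult_assoc; apply Rmult_le_compat_l; lra. }
    assert (Hm2 : 0 < INR m ^ 2) by (apply pow_lt; lra).
    assert (HNN : INR N ^ 2 <= 4 * INR M ^ 2 * INR m ^ 2).
    { replace (4 * INR M ^ 2 * INR m ^ 2) with ((2 * INR m * INR M) ^ 2) by ring.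
      apply pow_incr; split; [lra|]; rewrite <- HxM; apply Rmult_le_compat_r; lra. }
    assert (HNE : INR N * ratio_distance f p N N <= delta * INR N ^ 2).
    { apply Rmult_le_compat_l with (r := INR N) in H2; lra. }
    apply Rmult_le_compat_l with (r := INR N) in HW; [|lra].
    assert (HNE2 : 4 * (delta * INR N ^ 2) <= INR m ^ 2 * (K * delta)).
    { apply Rmult_le_compat_l with (r := 4 * delta) in HNN; [|lra].
      assert (0 <= delta * (INR M ^ 2 * INR m ^ 2))
        by (apply Rmult_le_pos; [lra|apply Rmult_le_pos; apply pow2_ge_0]).
      unfold K; lra. }
    apply Rmult_le_compat_l with (r := INR m ^ 2) in HNx; [|lra].
    apply Rle_lt_trans with ((1 + t) * (c + delta) + K * delta).
    - apply Rmult_le_reg_l with (INR m ^ 2); [assumption|]; lra.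
    - assert (t * (c + delta) <= t * (c + 1 + eta)) by (apply Rmult_le_compat_l; lra).
      lra. }
  (* For the lower bound the window starts at the given index [n]. The upper bound just proved is
     used again, to bound [t * y]. *)
  exists (2 * (N1 + N2 + M))%nat; intros n Hn.
  assert (Hy := Hupper n Hn); apply Rabs_def1; [lra|].
  assert (HMp : (0 < M)%nat) by (apply INR_lt; simpl; lra).
  assert (Hm := INR_div_bounds n M HMp); set (m := (n / M)%nat) in *.
  set (N := (n + m + m)%nat).
  destruct (Hwin N n m eq_refl) as [_ HW]; specialize (H2 N ltac:(unfold N; lia)).
  specialize (H1 N ltac:(unfold N; lia)); apply Rabs_def2 in H1.
  assert (HNR : INR N = INR n + 2 * INR m) by (unfold N; rewrite !plus_INR; ring).
  set (x := INR n / INR M) in *.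
  assert (HxM : x * INR M = INR n) by (unfold x; field; lra).
  assert (HnM : 2 * INR M <= INR n)
    by (change 2 with (INR 2); rewrite <- mult_INR; apply le_INR; lia).
  assert (Hx : 2 <= x) by (apply Rmult_le_reg_r with (INR M); lra).
  assert (HNM : INR N <= 3 * INR m * INR M).
  { apply Rle_trans with (x * (INR M + 2)); [lra|].
    apply Rle_trans with (2 * INR m * (INR M + 2)); [apply Rmult_le_compat_r; lra|nra]. }
  assert (HNn : INR N <= (1 + t) * INR n).
  { assert (2 * x <= (t * INR M) * x) by (apply Rmult_le_compat_r; lra).
    rewrite <- HxM in *; lra. }
  assert (HfN : f N <= f n) by (apply decreasing_prop; [assumption|unfold N; lia]).
  assert (Hrn := Hr n); assert (HfN0 := Hf N).
  assert (HNy : INR N * (f N * r n) <= (1 + t) * (INR n * f n * r n)).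
  { apply Rle_trans with ((1 + t) * INR n * (f n * r n)); [|lra].
    apply Rmult_le_compat; [lra|nra|assumption|apply Rmult_le_compat_r; lra]. }
  assert (Hm2 : 0 < INR m ^ 2) by (apply pow_lt; lra).
  assert (HNN : INR N ^ 2 <= 9 * INR M ^ 2 * INR m ^ 2).
  { replace (9 * INR M ^ 2 * INR m ^ 2) with ((3 * INR m * INR M) ^ 2) by ring.
    apply pow_incr; split; [lra|assumption]. }
  assert (HNE : INR N * ratio_distance f p N N <= delta * INR N ^ 2).
  { apply Rmult_le_compat_l with (r := INR N) in H2; lra. }
  apply Rmult_le_compat_l with (r := INR N) in HW; [|lra].
  assert (HNE2 : 4 * (delta * INR N ^ 2) <= INR m ^ 2 * (K * delta)).
  { apply Rmult_le_compat_l with (r := 4 * delta) in HNN; [|lra]; unfold K; lra. }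
  apply Rmult_le_compat_l with (r := INR m ^ 2) in HNy; [|lra].
  set (y := INR n * f n * r n) in *.
  assert (Hmain : INR N * p N * q N <= (1 + t) * y + K * delta)
    by (apply Rmult_le_reg_l with (INR m ^ 2); [assumption|]; lra).
  assert (t * y <= t * (c + 1 + eta)) by (apply Rmult_le_compat_l; lra).
  lra.
Qed.

(** * Application to the discrete resolvent *)

Lemma sum_f_R0_sum1 (g h : nat -> R) (n : nat) :
  (forall j, g (S j) = h (S j)) -> sum_f_R0 g n = g O + sum1 h n.
Proof.
  intros H; induction n as [|n IH]; [simpl; ring|].
  rewrite tech5, IH, H; simpl; ring.
Qed.

(** Since [lam j - lam (S j)] is [k j] for [j >= 1] and [1 - S0] for [j = 0], the difference of
    consecutive convolutions is the difference of the two sides of the resolvent equation, which is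
    zero. *)
Lemma conv_tail_lambda_resolvent (k r : nat -> R) (S0 : R) :
  is_resolvent (- S0) k r -> forall n, conv (tail_lambda k S0) r n = 1.
Proof.
  intros [Hr0 Hr]; set (lam := tail_lambda k S0).
  induction n as [|n IH]; [unfold conv; simpl; lra|].
  assert (H := sum_f_R0_sum1 (fun j => (lam j - lam (S j)) * r (n - j)%nat)
                 (fun j => k j * r (n - j)%nat) n ltac:(intros; simpl; ring)).
  rewrite (sum_eq _ (fun j => lam j * r (n - j)%nat - lam (S j) * r (n - j)%nat)), minus_sum in H
    by (intros; ring).
  specialize (Hr n); unfold conv in *.
  rewrite IH, Nat.sub_0_r in H; rewrite decomp_sum by lia; simpl in *; lra.
Qed.

Theorem theorem4p1 (k : nat -> R) (Ssum a alpha : R) (L r : nat -> R) :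
  (forall n : nat, (1 <= n)%nat -> 0 < k n) ->
  Un_cv (fun N => sum1 k N) Ssum ->
  Ssum <= 1 ->
  a = - Ssum ->
  (forall n : nat, (1 <= n)%nat ->
     (tail_lambda k Ssum n) ^ 2 <= tail_lambda k Ssum (n - 1) * tail_lambda k Ssum (n + 1)) ->
  0 < alpha < 1 ->
  slowly_varying L ->
  (forall n : nat, (1 <= n)%nat -> tail_lambda k Ssum n = L n * Rpower (INR n) (- alpha)) ->
  is_resolvent a k r ->
  Un_cv (fun n => Rpower (INR n) (1 - alpha) * L n * r n) (sin (alpha * PI) / PI).
Proof.
  intros Hk HS HS1 -> HK Hal [HL HLlim] Hlam Hres.
  set (lam := tail_lambda k Ssum) in *.
  assert (Hpos : forall n, 0 < lam n).
  { intros [|n]; [simpl; lra|]; rewrite Hlam by lia.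
    apply Rmult_lt_0_compat; [apply HL|apply exp_pos]. }
  assert (Hdec : Un_decreasing lam).
  (* From index [0] to [1] the decrease is the hypothesis [Ssum <= 1]. *)
  { intros [|n]; simpl; [lra|]; specialize (Hk (S n) ltac:(lia)); lra. }
  assert (Hlim : is_lim_seq lam 0).
  { apply is_lim_seq_incr_1, is_lim_seq_ext with (fun n => Ssum - sum1 k n); [reflexivity|].
    rewrite <- (Rminus_diag Ssum); apply is_lim_seq_minus'; [apply is_lim_seq_const|].
    now apply is_lim_seq_Reals. }
  assert (Hconv := conv_tail_lambda_resolvent k r Ssum Hres); fold lam in Hconv.
  assert (Hlogconvex : forall n, lam (S n) ^ 2 <= lam n * lam (S (S n))).
  { intros n; specialize (HK (S n) ltac:(lia)); rewrite Nat.add_1_r in HK.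
    simpl (S n - 1)%nat in HK; now rewrite Nat.sub_0_r in HK. }
  assert (Hrdec := kaluza_decreasing lam r Hpos Hlogconvex eq_refl Hconv).
  assert (Hr := conv_inverse_nonneg lam r Hpos Hdec Hlim eq_refl Hconv Hrdec).
  assert (Hreg : regular_decreasing alpha lam).
  { apply regular_decreasing_intro with L; trivial; intros i M HiM.
    assert (HI : 0 < INR i) by (apply lt_0_INR; lia); assert (HM : 0 < INR M) by (apply lt_0_INR; lia).
    assert (Hx : 0 < INR i / INR M) by (now apply Rdiv_lt_0_compat).
    specialize (HLlim _ Hx); rewrite Rpower_O in HLlim by assumption.
    apply is_lim_seq_Reals in HLlim; revert HLlim; apply is_lim_seq_ext; intros n.
    now rewrite nat_floor_div by lia. }
  apply is_lim_seq_Reals.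
  apply is_lim_seq_ext_loc with (fun n => INR n * lam n * r n);
    [|now apply conv_inverse_asymptotics].
  exists 1%nat; intros n Hn; rewrite Hlam by assumption.
  unfold Rminus; rewrite Rpower_plus, Rpower_1 by (apply lt_0_INR; lia); ring.
Qed.
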